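(* Let $A$ and $B$ be simplicial sets. If $f\colon X\to Y$ is a fiberwise homotopy equivalence in $(\mathrm{Set}_\Delta)_{/(A\times B)}$ then $f$ is a bivariant equivalence. If $X\to A\times B$ and $Y\to A\times B$ are bifibrations then the converse is also true, i.e. every bivariant equivalence $f\colon X\to Y$ in $(\mathrm{Set}_\Delta)_{/(A\times B)}$ is a fiberwise homotopy equivalence.
   Context: A map $(p,q)\colon X\to A\times B$ of simplicial sets is a bifibration if: (1) it is an inner fibration; (2) for every $n\geq 1$ it has diagonal fillers for every lifting problem against $\Lambda^n_0\subseteq\Delta^n$ whose bottom map $f\colon\Delta^n\to A\times B$ has $\pi_B f|\Delta^{\{0,1\}}$ degenerate in $B$; (3) for every $n\geq 1$ it has diagonal fillers for every lifting problem against $\Lambda^n_n\subseteq\Delta^n$ whose bottom map $f$ has $\pi_A f|\Delta^{\{n-1,n\}}$ degenerate in $A$. For objects $M,X$ of $(\mathrm{Set}_\Delta)_{/(A\times B)}$, $\mathrm{map}_{A\times B}(M,X)$ is the fiber of $X^M\to(A\times B)^M$ over the structure map $M\to A\times B$; it is a Kan complex when $X\to A\times B$ is a bifibration. A map $Y\to Z$ in $(\mathrm{Set}_\Delta)_{/(A\times B)}$ is a bivariant equivalence if $\mathrm{map}_{A\times B}(Z,X)\to\mathrm{map}_{A\times B}(Y,X)$ is a homotopy equivalence for every bifibration $X\to A\times B$. A fiberwise homotopy between maps $f,g\colon X\to Y$ in $(\mathrm{Set}_\Delta)_{/(A\times B)}$ is an edge of $\mathrm{map}_{A\times B}(X,Y)$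 between the vertices $f$ and $g$. A map $h\colon X\to Y$ in $(\mathrm{Set}_\Delta)_{/(A\times B)}$ is a fiberwise homotopy equivalence if there is a map $k\colon Y\to X$ in $(\mathrm{Set}_\Delta)_{/(A\times B)}$ such that $hk$ and $1_Y$ are fiberwise homotopic and $kh$ and $1_X$ are fiberwise homotopic. *)

(* Defs.v *)
From HB Require Import structures.
From mathcomp Require Import all_boot.
From mathcomp Require Import boolp.

Set Implicit Arguments.
Unset Strict Implicit.
Unset Printing Implicit Defensive.

(* The ordinal [n] = {0 < ... < n} is 'I_n.+1. *)
Definition monotone m n (f : {ffun 'I_m.+1 -> 'I_n.+1}) : bool :=
  [forall i : 'I_m.+1, forall j : 'I_m.+1, (i <= j) ==> (f i <= f j)].

Record mono m n := Mono {
  mono_fun :> {ffun 'I_m.+1 -> 'I_n.+1};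
  _ : monotone mono_fun }.

HB.instance Definition _ m n := [isSub for @mono_fun m n].

Lemma monoP m n (a : mono m n) (i j : 'I_m.+1) : i <= j -> a i <= a j.
Proof.
move=> ij; case: a => f /= /forallP /(_ i) /forallP /(_ j) /implyP; exact.
Qed.

Lemma mono_ext m n (a b : mono m n) : a =1 b -> a = b.
Proof. by move=> ab; apply: val_inj; apply/ffunP. Qed.

Lemma monotoneI m n (f : 'I_m.+1 -> 'I_n.+1) :
  (forall i j : 'I_m.+1, i <= j -> f i <= f j) -> monotone (finfun f).
Proof.
move=> fP; apply/forallP => i; apply/forallP => j; apply/implyP => ij.
by rewrite !ffunE fP.
Qed.

Definition mono_id n : mono n n :=
  Mono (@monotoneI n n id (fun _ _ ij => ij)).

Definition mono_comp m n p (b : mono n p) (a : mono m n) : mono m p :=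
  Mono (monotoneI (fun i j ij => monoP b (monoP a ij))).

Definition mono_const m n (k : 'I_n.+1) : mono m n :=
  Mono (@monotoneI m n (fun=> k) (fun _ _ _ => leqnn k)).

(* [first_edge n] and [last_edge n] are the edges {0, 1} and {n, n+1}. *)
Fact first_edge_subproof n (i j : 'I_2) :
  i <= j -> (inord i : 'I_n.+2) <= (inord j : 'I_n.+2).
Proof.
by move=> ij; rewrite !inordK // (leq_trans (ltn_ord _)).
Qed.

Definition first_edge n : mono 1 n.+1 :=
  Mono (monotoneI (@first_edge_subproof n)).

Fact last_edge_subproof n (i j : 'I_2) :
  i <= j -> (inord (n + i) : 'I_n.+2) <= (inord (n + j) : 'I_n.+2).
Proof.
have b (k : 'I_2) : n + k < n.+2 by rewrite -(addn2 n) ltn_add2l ltn_ord.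
by move=> ij; rewrite !inordK // leq_add2l.
Qed.

Definition last_edge n : mono 1 n.+1 :=
  Mono (monotoneI (@last_edge_subproof n)).

Record sset := SSet {
  simp :> nat -> Type;
  act : forall m n, mono m n -> simp n -> simp m;
  act_id : forall n (x : simp n), act (mono_id n) x = x;
  act_comp : forall m n p (b : mono n p) (a : mono m n) (x : simp p),
    act (mono_comp b a) x = act a (act b x) }.

Record smap (X Y : sset) := SMap {
  smap_fun :> forall n, X n -> Y n;
  smap_nat : forall m n (a : mono m n) (x : X n),
    smap_fun (act a x) = act a (smap_fun x) }.

Lemma smap_ext (X Y : sset) (f g : smap X Y) :
  (forall n (x : X n), f n x = g n x) -> f = g.
Proof.
case: f g => [f fN] [g gN] /= fg.
have e : f = g by apply: functional_extensionality_dep => n; apply: funext.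
by case: _ / e gN => gN; congr SMap; apply: Prop_irrelevance.
Qed.

Definition sid (X : sset) : smap X X :=
  @SMap X X (fun _ x => x) (fun _ _ _ _ => erefl).

Definition scomp (X Y Z : sset) (g : smap Y Z) (f : smap X Y) : smap X Z.
Proof.
by exists (fun n x => g n (f n x)) => m n a x; rewrite !smap_nat.
Defined.

Definition sprod (X Y : sset) : sset.
Proof.
exists (fun n => X n * Y n)%type (fun _ _ a x => (act a x.1, act a x.2)).
- by move=> n [x y]; rewrite !act_id.
- by move=> m n p b a [x y]; rewrite !act_comp.
Defined.

Definition sfst (X Y : sset) : smap (sprod X Y) X :=
  @SMap (sprod X Y) X (fun _ x => x.1) (fun _ _ _ _ => erefl).

Definition ssnd (X Y : sset) : smap (sprod X Y) Y :=
  @SMap (sprod X Y) Y (fun _ x => x.2) (fun _ _ _ _ => erefl).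

Definition sprod_map (X Y X' Y' : sset) (f : smap X X') (g : smap Y Y') :
  smap (sprod X Y) (sprod X' Y').
Proof.
by exists (fun n x => (f n x.1, g n x.2) : sprod X' Y' n) => m n a [x y];
   rewrite /= !smap_nat.
Defined.

Definition simplex (n : nat) : sset.
Proof.
exists (fun m => mono m n) (fun _ _ a t => mono_comp t a).
- by move=> m t; apply: mono_ext => i; rewrite !ffunE.
- by move=> m k p b a t; apply: mono_ext => i; rewrite !ffunE.
Defined.

Definition simplex_map m n (a : mono m n) : smap (simplex m) (simplex n).
Proof.
exists (fun k (t : simplex m k) => mono_comp a t : simplex n k) => k l b t.
by apply: mono_ext => i; rewrite !ffunE.
Defined.

(* A simplex of Delta^n lies in the k-th horn when it misses some vertex
   other than k. *)
Definition in_horn n (k : 'I_n.+1) m (t : mono m n) : bool :=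
  [exists j, (j != k) && (j \notin codom t)].

Lemma in_horn_act n (k : 'I_n.+1) m p (a : mono m p) (t : mono p n) :
  in_horn k t -> in_horn k (mono_comp t a).
Proof.
move=> /existsP[j /andP[jk jt]]; apply/existsP; exists j; rewrite jk /=.
apply: contra jt => /codomP[i ->]; rewrite ffunE; exact: codom_f.
Qed.

Definition horn n (k : 'I_n.+1) : sset.
Proof.
exists (fun m => {t : mono m n | in_horn k t})
       (fun _ _ a t => exist _ (mono_comp (sval t) a) (in_horn_act a (svalP t))).
- by move=> m t; apply: val_inj; apply: (@act_id (simplex n)).
- by move=> m q p b a t; apply: val_inj; apply: (@act_comp (simplex n)).
Defined.

Definition horn_incl n (k : 'I_n.+1) : smap (horn k) (simplex n) :=
  @SMap (horn k) (simplex n) (fun _ t => sval t) (fun _ _ _ _ => erefl).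

Definition has_filler (X Y I J : sset)
    (p : smap X Y) (i : smap I J) (u : smap I X) (v : smap J Y) : Prop :=
  exists d : smap J X, scomp d i = u /\ scomp p d = v.

Definition inner_fibration (X Y : sset) (p : smap X Y) : Prop :=
  forall n (k : 'I_n.+1), 0 < k < n ->
  forall (u : smap (horn k) X) (v : smap (simplex n) Y),
    scomp p u = scomp v (horn_incl k) -> has_filler p (horn_incl k) u v.

Definition degenerate_edge (X : sset) (e : X 1) : Prop :=
  exists x : X 0, e = act (mono_const 1 ord0) x.

(* The positive dimension of the horns in the last two clauses is n.+1. *)
Definition bifibration (A B X : sset) (p : smap X (sprod A B)) : Prop :=
  [/\ inner_fibration p,
      forall n (u : smap (horn (ord0 : 'I_n.+2)) X)
             (v : smap (simplex n.+1) (sprod A B)),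
        scomp p u = scomp v (horn_incl ord0) ->
        degenerate_edge (scomp (ssnd A B) v 1 (first_edge n)) ->
        has_filler p (horn_incl ord0) u v
    & forall n (u : smap (horn (ord_max : 'I_n.+2)) X)
             (v : smap (simplex n.+1) (sprod A B)),
        scomp p u = scomp v (horn_incl ord_max) ->
        degenerate_edge (scomp (sfst A B) v 1 (last_edge n)) ->
        has_filler p (horn_incl ord_max) u v].

(* X^M, with n-simplices the maps M * Delta^n -> X. *)
Definition shom (M X : sset) : sset.
Proof.
exists (fun n => smap (sprod M (simplex n)) X)
       (fun _ _ a h => scomp h (sprod_map (sid M) (simplex_map a))).
- move=> n h; apply: smap_ext => k [x t] /=; congr (h k (_, _)).
  by apply: mono_ext => i; rewrite !ffunE.
- move=> m n p b a h; apply: smap_ext => k [x t] /=; congr (h k (_, _)).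
  by apply: mono_ext => i; rewrite !ffunE.
Defined.

Definition shom_post (M X Y : sset) (p : smap X Y) :
  smap (shom M X) (shom M Y).
Proof.
by exists (fun n (h : shom M X n) => scomp p h : shom M Y n) => m n a h;
   apply: smap_ext.
Defined.

Definition shom_pre (M N X : sset) (f : smap M N) :
  smap (shom N X) (shom M X).
Proof.
by exists (fun n (h : shom N X n) =>
     scomp h (sprod_map f (sid (simplex n))) : shom M X n) => m n a h;
   apply: smap_ext.
Defined.

(* The vertex of X^M corresponding to a map M -> X. *)
Definition shom_vertex (M X : sset) (f : smap M X) : shom M X 0 :=
  scomp f (sfst M (simplex 0)).

Definition sfiber (E S : sset) (p : smap E S) (s : S 0) : sset.
Proof.
unshelve refine (@SSet (fun n => {e : E n | p n e = act (mono_const n ord0) s})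
  (fun m n a e => exist _ (act a (sval e)) _) _ _).
- rewrite smap_nat (svalP e) -act_comp; congr act.
  by apply: mono_ext => i; rewrite !ffunE.
- by move=> n [e eP]; apply: eq_exist; rewrite /= act_id.
- by move=> m n q b a [e eP]; apply: eq_exist; rewrite /= act_comp.
Defined.

Record over (S : sset) := Over {
  tot :> sset;
  str : smap tot S }.

Record over_map (S : sset) (X Y : over S) := OverMap {
  over_fun :> smap X Y;
  over_comm : scomp (str Y) over_fun = str X }.

Definition oid (S : sset) (X : over S) : over_map X X.
Proof. by exists (sid X); apply: smap_ext. Defined.

Definition ocomp (S : sset) (X Y Z : over S)
  (g : over_map Y Z) (f : over_map X Y) : over_map X Z.
Proof.
exists (scomp g f); rewrite -(over_comm f) -(over_comm g).
exact: smap_ext.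
Defined.

Definition map_over (S : sset) (M X : over S) : sset :=
  sfiber (shom_post M (str X)) (shom_vertex (str M)).

Definition map_over_vertex (S : sset) (M X : over S) (f : over_map M X) :
  map_over M X 0.
Proof.
exists (shom_vertex f); rewrite -(over_comm f).
exact: smap_ext.
Defined.

Definition map_over_pre (S : sset) (M N : over S) (f : over_map M N)
  (X : over S) : smap (map_over N X) (map_over M X).
Proof.
unshelve refine (@SMap (map_over N X) (map_over M X)
  (fun n h => exist _ (shom_pre X f n (sval h)) _) _).
- have hP := svalP h; rewrite -(over_comm f).
  apply: smap_ext => k [x t].
  have := congr1 (fun g : smap (sprod N (simplex n)) S => g k (f k x, t)) hP.
  exact.
- by move=> m n a h; apply: eq_exist; rewrite smap_nat.
Defined.

(* Function complexes over S need not be Kan, so the direction of the edge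
   matters; "an edge between x and y" is read symmetrically. *)
Definition edge_from_to (K : sset) (x y : K 0) (e : K 1) : Prop :=
  act (mono_const 0 (ord0 : 'I_2)) e = x /\
  act (mono_const 0 (ord_max : 'I_2)) e = y.

Definition edge_between (K : sset) (x y : K 0) (e : K 1) : Prop :=
  edge_from_to x y e \/ edge_from_to y x e.

Definition homotopic (X Y : sset) (f g : smap X Y) : Prop :=
  exists e : shom X Y 1, edge_between (shom_vertex f) (shom_vertex g) e.

Definition homotopy_equivalence (X Y : sset) (f : smap X Y) : Prop :=
  exists g : smap Y X,
    homotopic (scomp f g) (sid Y) /\ homotopic (scomp g f) (sid X).

Definition fiberwise_homotopy (S : sset) (X Y : over S) (f g : over_map X Y)
  (e : map_over X Y 1) : Prop :=
  edge_between (map_over_vertex f) (map_over_vertex g) e.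

Definition fiberwise_homotopic (S : sset) (X Y : over S)
  (f g : over_map X Y) : Prop :=
  exists e : map_over X Y 1, fiberwise_homotopy f g e.

Definition fiberwise_homotopy_equivalence (S : sset) (X Y : over S)
  (h : over_map X Y) : Prop :=
  exists k : over_map Y X,
    fiberwise_homotopic (ocomp h k) (oid Y) /\
    fiberwise_homotopic (ocomp k h) (oid X).

Definition bivariant_equivalence (A B : sset) (Y Z : over (sprod A B))
  (f : over_map Y Z) : Prop :=
  forall X : over (sprod A B), bifibration (str X) ->
    homotopy_equivalence (map_over_pre f X).

(* Main.v *)
From mathcomp Require Import all_boot.
From mathcomp Require Import boolp classical_sets zify.
Require Import Defs.

Set Implicit Arguments.
Unset Strict Implicit.
Unset Printing Implicit Defensive.

(** If [k] is a fiberwise homotopy inverse of [f], then precomposition with [k]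
    is a homotopy inverse of precomposition with [f] on function complexes into
    any [W]: an edge between [kf] and the identity in the complex of fiberwise
    maps X -> X becomes, by substitution into maps X -> W, a homotopy between
    [(kf)^*] and the identity ([homotopic_precomp]).

    For the converse, test [f] against X and Y.  A homotopy inverse [g] of
    [f^*] : map(Y, X) -> map(X, X) sends the identity of X to a map
    [k] : Y -> X, and evaluating the homotopy between [f^* g] and the identity
    at the vertex 1_X gives an edge between [kf] and 1_X.  Postcomposing with
    [f], the vertices [f^*(fk)] and [f^*(1_Y)] of map(X, Y) are joined by an edge.
    Applying a homotopy inverse [g'] of [f^*] : map(Y, Y) -> map(X, Y) and the
    homotopy between [g' f^*] and the identity, [fk] and 1_Y are joined by a
    chain of three edges of map(Y, Y), of unknown directions.  A fiberwise
    homotopy is a single edge, so the chain has to be contracted, and this is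
    the only place where the fibration conditions enter.

    One consequence of map(M, X) being a Kan complex suffices: an open square,
    given by its bottom and its two vertical sides, has a top side
    ([joined_box]); this already makes being joined by an edge an equivalence
    relation.  With N = M * Delta^1 the open square is a map on
    N0 * Delta^1 \cup N * {0}, for the subcomplex N0 = M * {0, 1} of N, to be
    extended to N * Delta^1 over the projection to N
    ([fiberwise_homotopy_extension]).  By Zorn's lemma there is a maximal
    extension, and a simplex x of N of least dimension n over which it is not
    defined behaves like a nondegenerate simplex with known boundary; the
    prism over x is then filled by attaching n + 1 simplices of dimension
    n + 1, along horns of index n, ..., 1, 0.  Only the last horn is not
    inner, and its first edge runs in the direction of the homotopy, hence is
    degenerate in the base, as the definition of a bifibration requires for
    left outer horns. *)

(** * Monotone maps *)

Lemma mono_exists m n (f : 'I_m.+1 -> nat) :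
  (forall v, f v <= n) -> (forall v w : 'I_m.+1, v <= w -> f v <= f w) ->
  exists t : mono m n, forall v, t v = f v :> nat.
Proof.
move=> fn fh.
have h (v w : 'I_m.+1) :
    v <= w -> (inord (f v) : 'I_n.+1) <= (inord (f w) : 'I_n.+1).
  by move=> vw; rewrite !inordK ?ltnS ?fh.
by exists (Mono (monotoneI h)) => v; rewrite ffunE inordK // ltnS.
Qed.

Lemma mono_eq m n (s t : mono m n) : (forall v, s v = t v :> nat) -> s = t.
Proof. by move=> st; apply: mono_ext => v; apply: val_inj; apply: st. Qed.

Lemma mono_compE m n p (b : mono n p) (a : mono m n) v :
  mono_comp b a v = b (a v).
Proof. by rewrite ffunE. Qed.

Lemma mono_constE m n (k : 'I_n.+1) (v : 'I_m.+1) : mono_const m k v = k.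
Proof. by rewrite ffunE. Qed.

Lemma mono_comp_const m n p (b : mono m n) (k : 'I_p.+1) :
  mono_comp (mono_const n k) b = mono_const m k.
Proof. by apply: mono_ext => v; rewrite !ffunE. Qed.

Definition surjective m n (t : mono m n) := forall j, exists v, t v = j.

(** The choice of [v] is what makes sections detect equality: maps that agree
    after composition with every section of [t] agree at every [v]. *)
Lemma section_through m n (t : mono m n) (v : 'I_m.+1) : surjective t ->
  exists s : mono n m, mono_comp t s = mono_id n /\ s (t v) = v.
Proof.
move=> tS.
have [g gE] := choice tS.
pose h j := if j == t v then v else g j.
have hE j : t (h j) = j by rewrite /h; case: eqP => [->|].
have [j||s sE] := @mono_exists n m (fun j => h j).
- by rewrite -ltnS ltn_ord.
- (* Any section of a monotone map is monotone. *)
  move=> i j ij; rewrite leqNgt; apply/negP => ji.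
  have := monoP t (ltnW ji); rewrite !hE => ji'.
  have e : i = j by apply/val_inj/anti_leq; rewrite ij ji'.
  by rewrite e ltnn in ji.
exists s; split; last by apply: val_inj; rewrite /= sE /h eqxx.
apply: mono_ext => j; rewrite !ffunE -[RHS]hE; congr (t _).
exact/val_inj/sE.
Qed.

Lemma non_surjective_factor m n (t : mono m n) : ~ surjective t ->
  exists n' (d : mono n' n) (t' : mono m n'), n' < n /\ t = mono_comp d t'.
Proof.
move=> /existsNP[j /forallNP tj].
have tj' v : t v <> j :> nat by move=> e; apply: (tj v); apply: val_inj.
case: n t j tj tj' => [|n] t j tj tj'.
  by case: (tj ord0); rewrite [t _]ord1 [j]ord1.
have [v||d dE] := @mono_exists n n.+1 (fun v => bump j v).
- by rewrite /bump; move: (ltn_ord v); lia.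
- by move=> v w; rewrite /bump; lia.
have [v||t' tE] := @mono_exists m n (fun v => unbump j (t v)).
- by rewrite /unbump; move: (ltn_ord (t v)) (ltn_ord j) (tj' v); lia.
- by move=> v w /(monoP t); rewrite /unbump; lia.
exists n, d, t'; split=> //; apply: mono_eq => v.
rewrite mono_compE dE tE /bump /unbump; move: (tj' v); lia.
Qed.

Lemma surjective_endo_id n (t : mono n n) : surjective t -> t = mono_id n.
Proof.
move=> /[dup] tS /(section_through ord0)[s [ts _]].
have sI : injective s.
  apply: (@can_inj _ _ _ t) => j.
  by have /(congr1 (fun a : mono n n => a j)) := ts; rewrite !ffunE.
(* A monotone injection of a finite ordinal into itself moves nothing down,
   and, read from the top, nothing up. *)
have lts : forall k (j : 'I_n.+1), j = k :> nat -> j <= s j.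
  elim=> [j ->//|k IH j jk].
  have kn : k < n.+1 by rewrite ltnW // -jk.
  have := IH (Ordinal kn) erefl => /= ks.
  have kj : Ordinal kn <= j by rewrite /= jk.
  have := monoP s kj.
  rewrite leq_eqVlt => /orP[/eqP/val_inj/sI e|].
    by move: jk; rewrite -e /=; lia.
  by rewrite jk; apply: leq_ltn_trans.
have gts : forall k (j : 'I_n.+1), n - j = k -> s j <= j.
  elim=> [j|k IH j jk].
    by move: (ltn_ord j) (ltn_ord (s j)); lia.
  have kn : j.+1 < n.+1 by lia.
  have := IH (Ordinal kn) => /= /(_ ltac:(lia)) ks.
  have kj : j <= Ordinal kn by rewrite /=.
  have := monoP s kj.
  rewrite leq_eqVlt => /orP[/eqP/val_inj/sI e|]; last by lia.
  by move: (congr1 val e) => /=; lia.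
have sE j : s j = j.
  by apply: val_inj; apply: anti_leq; rewrite (lts j) ?(gts _ j erefl).
apply: mono_ext => j; have /(congr1 (fun a : mono n n => a j)) := ts.
by rewrite !ffunE sE.
Qed.

(** * Simplices of least dimension outside a subcomplex *)

Definition subcomplex (N : sset) (D : forall n, N n -> Prop) :=
  forall m n (a : mono m n) x, D n x -> D m (act a x).

(** When [x] has least dimension among the simplices outside [D], its boundary
    lies in [D] while its degeneracies do not, and [x] is nondegenerate.  The
    three lemmas below give, relative to [D], the part of the Eilenberg-Zilber
    lemma that is needed to attach cells, without decomposing an arbitrary
    simplex into a degeneracy of a nondegenerate one. *)
Section MinimalSimplex.
Variables (N : sset) (D : forall n, N n -> Prop) (n : nat) (x : N n).
Hypotheses (Dsub : subcomplex D) (xD : ~ D x)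
  (Dlow : forall m (y : N m), m < n -> D y).

Lemma minimal_face m (t : mono m n) : ~ surjective t -> D (act t x).
Proof.
move=> /non_surjective_factor[n' [d [t' [lt ->]]]].
by rewrite act_comp; apply/Dsub/Dlow.
Qed.

Lemma minimal_degeneracy m (t : mono m n) : surjective t -> ~ D (act t x).
Proof.
move=> /(section_through ord0)[s [ts _]] /(Dsub s).
by rewrite -act_comp ts act_id.
Qed.

(** If [t v] and [t' v] differed, a section [s] of [t] through [v] would write
    [x] as [act (t' s) x] with [t' s] an endomorphism other than the identity,
    hence not surjective, and [x] would be one of its own boundary faces. *)
Lemma minimal_inj m (t t' : mono m n) :
  surjective t -> act t x = act t' x -> t = t'.
Proof.
move=> tS e; apply: mono_ext => v; apply: contrapT => tv.
have [s [ts sv]] := section_through v tS.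
have e' : x = act (mono_comp t' s) x by rewrite act_comp -e -act_comp ts act_id.
apply: xD; rewrite e'; apply: minimal_face => /surjective_endo_id.
move=> /(congr1 (fun a : mono n n => a (t v))).
by rewrite mono_compE sv ffunE => e''; apply: tv.
Qed.

End MinimalSimplex.

(** * Partial lifts *)

Definition yoneda (X : sset) n (x : X n) : smap (simplex n) X.
Proof.
by exists (fun m (t : simplex n m) => act t x) => m k a t; rewrite -act_comp.
Defined.

Lemma smap_of_graph (P X : sset) (R : forall n, P n -> X n -> Prop) :
  (forall n (s : P n), exists x, R n s x) ->
  (forall n (s : P n) x x', R n s x -> R n s x' -> x = x') ->
  (forall m n (a : mono m n) s x, R n s x -> R m (act a s) (act a x)) ->
  exists d : smap P X, forall n s, R n s (d n s).
Proof.
move=> Rt Rf Ra.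
pose d n s := sval (cid (Rt n s)).
have dE n s : R n s (d n s) by rewrite /d; case: cid.
unshelve eexists (@SMap P X d _) => //=.
by move=> m n a s; apply: Rf (dE _ _) _; apply: Ra.
Qed.

(** A partial lift of [w] along [p], defined on a subcomplex of [P], is encoded
    by its graph: graphs are ordered by inclusion, and the union of a chain of
    partial lifts is a partial lift without any gluing. *)
Section PartialLift.
Variables (P X S : sset) (w : smap P S) (p : smap X S).

Record partial_lift (R : forall n, P n -> X n -> Prop) : Prop := PartialLift {
  pl_fun : forall n (s : P n) x x', R n s x -> R n s x' -> x = x';
  pl_act : forall m n (a : mono m n) s x, R n s x -> R m (act a s) (act a x);
  pl_over : forall n (s : P n) x, R n s x -> p n x = w n s }.

Definition extends (R R' : forall n, P n -> X n -> Prop) :=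
  forall n s x, R n s x -> R' n s x.

Definition dom (R : forall n, P n -> X n -> Prop) n (s : P n) :=
  exists x, R n s x.

Lemma dom_sub R : partial_lift R -> subcomplex (dom R).
Proof. by move=> RP m n a s [x xP]; exists (act a x); apply: pl_act. Qed.

(** The simplex [s] meets the domain of [R] exactly in its [k]-th horn and is
    injective elsewhere, so its image together with the domain is the pushout
    of the horn inclusion; a filler of the horn glues to [R]. *)
Lemma attach_horn R n (k : 'I_n.+1) (s : P n) : partial_lift R ->
  (forall m (t : mono m n), in_horn k t -> dom R (act t s)) ->
  (forall m (t : mono m n), ~~ in_horn k t -> ~ dom R (act t s)) ->
  (forall m (t t' : mono m n),
     ~~ in_horn k t -> act t s = act t' s -> t = t') ->
  (forall u, scomp p u = scomp (yoneda (w n s)) (horn_incl k) ->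
     has_filler p (horn_incl k) u (yoneda (w n s))) ->
  exists R', [/\ partial_lift R', extends R R' &
    forall m (y : P m), dom R' y <-> dom R y \/ exists t, y = act t s].
Proof.
move=> RP hornR freshR injs fill.
have [|||u uE] :=
    @smap_of_graph (horn k) X (fun m t x => R m (act (sval t) s) x).
- by move=> m [t tk]; apply: hornR.
- by move=> m t x x'; apply: (pl_fun RP).
- by move=> m m' a t x /(pl_act RP a); rewrite -act_comp.
have [|d [du pd]] := fill u.
  by apply: smap_ext => m t; rewrite /= (pl_over RP (uE m t)) smap_nat.
(* By the Yoneda lemma the filler is determined by this simplex. *)
pose z := d n (mono_id n : simplex n n).
have dz m (t : mono m n) : d m (t : simplex n m) = act t z.
  rewrite -smap_nat /=; congr (d m _).
  by apply: mono_ext => v; rewrite !ffunE.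
have pz : p n z = w n s.
  have /(congr1 (fun g : smap _ S => g n (mono_id n : simplex n n))) := pd.
  by rewrite /= act_id.
have zR m (t : mono m n) : in_horn k t -> R m (act t s) (act t z).
  move=> tk; rewrite -dz.
  have /(congr1 (fun g : smap (horn k) X => g m (exist _ t tk))) := du.
  by move=> /= ->; apply: (uE m (exist _ t tk)).
have domE m (t : mono m n) : dom R (act t s) -> in_horn k t.
  by move=> ts; apply: contrapT => /negP /freshR; apply.
exists (fun m y x => R m y x \/ exists t, y = act t s /\ x = act t z); split.
- split.
  + move=> m y x x' [yx|[t [yt ->]]] [yx'|[t' [yt' ->]]].
    * exact: (pl_fun RP yx yx').
    * apply: (pl_fun RP yx); rewrite yt'; apply/zR/domE.
      by rewrite -yt'; exists x.
    * apply: (pl_fun RP) (yx'); rewrite yt; apply/zR/domE.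
      by rewrite -yt; exists x'.
    * case: (boolP (in_horn k t)) => [tk|tk].
        apply: (pl_fun RP (s := y)); first by rewrite yt; apply: zR.
        rewrite yt'; apply/zR/domE; rewrite -yt' yt.
        by exists (act t z); apply: zR.
      by rewrite (injs _ t t') // -yt.
  + move=> m m' a y x [yx|[t [-> ->]]]; first by left; apply: (pl_act RP).
    by right; exists (mono_comp t a); rewrite !act_comp.
  + move=> m y x [/(pl_over RP)//|[t [-> ->]]].
    by rewrite !smap_nat pz.
- by move=> m y x; left.
- move=> m y; split=> [[x [yx|[t [yt _]]]]|[[x yx]|[t yt]]].
  + by left; exists x.
  + by right; exists t.
  + by exists x; left.
  + by exists (act t z); right; exists t.
Qed.

(** The condition [C] on domains is there to let extensions be compared one
    whole prism at a time, instead of one simplex at a time. *)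
Lemma maximal_partial_lift (C : (forall n, P n -> Prop) -> Prop) R0 :
  partial_lift R0 -> C (dom R0) ->
  (forall (I : Type) (F : I -> forall n, P n -> Prop), I ->
     (forall i, C (F i)) -> C (fun n s => exists i, F i n s)) ->
  exists R, [/\ partial_lift R, C (dom R), extends R0 R &
     forall R', partial_lift R' -> C (dom R') -> extends R R' -> extends R' R].
Proof.
move=> R0P CR0 Cchain.
(* Each set is joined to [R0], so that even the empty chain has a union
   above [R0]. *)
pose T := {n : nat & (P n * X n)%type}.
pose rel (G : set T) n s x := R0 n s x \/ G (existT _ n (s, x)).
pose good G := partial_lift (rel G) /\ C (dom (rel G)).
have [|G [[GP GC] Gmax]] := @Zorn_bigcup T good.
- move=> F Fgood Ftot.
  have [[G1 FG1]|F0] := pselect (exists G, F G); last first.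
    have E : rel (\bigcup_(G in F) G)%classic = R0.
      apply: functional_extensionality_dep => n; apply: funext => s.
      apply: funext => x; apply: propext; split; last by left.
      by case=> // -[G FG]; case: F0; exists G.
    by rewrite /good E.
  pose I := {G : set T | F G}.
  have relE n s x : rel (\bigcup_(G in F) G)%classic n s x <->
      exists i : I, rel (sval i) n s x.
    split.
      case=> [r|[G FG Gx]]; first by exists (exist _ G1 FG1); left.
      by exists (exist _ G FG); right.
    by case=> -[G FG] /= [r|Gx]; [left|right; exists G].
  have relP (i : I) := (Fgood _ (svalP i)).1.
  split.
    split.
    + move=> n s x x' /relE[i ix] /relE[j jx'].
      have [ij|ji] := Ftot _ _ (svalP i) (svalP j).
        apply: (pl_fun (relP j)) jx'; case: ix => [|/ij]; first by left.
        by right.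
      apply: (pl_fun (relP i)) ix _; case: jx' => [|/ji]; first by left.
      by right.
    + by move=> m n a s x /relE[i ix]; apply/relE; exists i; apply: pl_act.
    + by move=> n s x /relE[i /(pl_over (relP i))].
  have -> : dom (rel (\bigcup_(G in F) G)%classic) =
      (fun n s => exists i : I, dom (rel (sval i)) s).
    apply: functional_extensionality_dep => n; apply: funext => s.
    apply: propext; split=> [[x /relE[i ix]]|[i [x ix]]].
      by exists i, x.
    by exists x; apply/relE; exists i.
  by apply: Cchain; [exists G1|move=> [G FG] /=; have [] := Fgood _ FG].
exists (rel G); split=> // [n s x|R' R'P CR' RR' n s x R'x]; first by left.
pose G' : set T := [set z | R' (tag z) (tagged z).1 (tagged z).2]%classic.
have E : rel G' = R'.
  apply: functional_extensionality_dep => m; apply: funext => y.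
  apply: funext => z; apply: propext; split; last by right.
  by case=> // r; apply: RR'; left.
have [GG'|] := pselect (G `<` G')%classic.
  by case: (Gmax _ GG'); rewrite /good E.
move=> nGG'; right; apply: contrapT => nG; apply: nGG'; split.
  by move=> [m [y z]] Gz; apply: RR'; right.
by move=> /(_ (existT _ n (s, x)) R'x).
Qed.

End PartialLift.

(** * Extending fiberwise homotopies *)

(** The map [g] is the [k]-th elementary degeneracy, so the horn lies over the
    degenerate simplex [s_k z] of the base.  These are the horns that occur in
    prisms over a constant homotopy.  For k = 0 the first edge of [s_0 z] is
    degenerate. *)
Definition fills_over_degeneracies (X S : sset) (p : smap X S) :=
  forall n (z : S n) (k : 'I_n.+2) (g : mono n.+1 n),
    k <= n -> (forall v, g v = v - (k < v) :> nat) ->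
    forall u, scomp p u = scomp (yoneda (act g z)) (horn_incl k) ->
    has_filler p (horn_incl k) u (yoneda (act g z)).

Lemma bifibration_fills (A B X : sset) (p : smap X (sprod A B)) :
  bifibration p -> fills_over_degeneracies p.
Proof.
move=> [inner left _] n z k g kn gE u pu.
have [k0|k0] := posnP k; last by apply: inner pu; rewrite k0 ltnS.
have e : k = ord0 by apply: val_inj.
rewrite {k}e in kn gE u pu k0 *; apply: left pu _.
exists (act (mono_const 0 ord0) z).2; rewrite /= -!act_comp; congr (act _ _).
apply: mono_eq => v; rewrite !mono_compE !mono_constE gE /= ffunE inordK.
  by case: v => [[|[|]]].
by apply: leq_trans (ltn_ord v) _.
Qed.

(** The product [N * Delta^1] lies over [S] through the projection to [N], so
    lifts are fiberwise homotopies with source [N].  The prescribed partial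
    homotopy always contains the bottom [N * {0}]. *)
Section Cylinder.
Variables (N X S : sset) (w : smap N S) (p : smap X S).
Hypothesis pfill : fills_over_degeneracies p.

Local Notation I := (simplex 1).
Local Notation P := (sprod N I).
Local Notation wP := (scomp w (sfst N I)).
Local Notation bottom m := (mono_const m (ord0 : 'I_2)).

(** For a subcomplex [D] containing the bottom, this says that [D] is
    [N0 * Delta^1 \cup N * {0}] for a subcomplex [N0] of [N]. *)
Definition saturated (D : forall m, P m -> Prop) :=
  forall m (y : N m) (s s' : mono m 1),
  s <> bottom m -> D m (y, s) -> D m (y, s').

Lemma not_bottom m (s : mono m 1) (v : 'I_m.+1) : 0 < s v -> s <> bottom m.
Proof. by move=> sv e; rewrite e mono_constE in sv. Qed.

Section Cell.
Variables (R : forall m, P m -> X m -> Prop) (n : nat) (x : N n).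
Hypotheses (RP : partial_lift wP p R) (Rsat : saturated (dom R))
  (Rbot : forall m (y : N m), dom R ((y, bottom m) : P m)).

Let full m (y : N m) := forall s : mono m 1, dom R ((y, s) : P m).

Hypotheses (xR : ~ full x) (Rlow : forall m (y : N m), m < n -> full y).

Lemma full_sub : subcomplex full.
Proof.
move=> m m' a y yF s; apply: (Rsat (s := mono_const m ord_max)).
  by apply: (@not_bottom _ _ ord0); rewrite mono_constE.
rewrite -(mono_comp_const a ord_max).
by have := dom_sub RP a (yF (mono_const m' ord_max)).
Qed.

(** A simplex (t, r) of Delta^n * Delta^1 is a chain whose vertices have r = 0
    first and r = 1 afterwards.  The prism is filtered by the subcomplexes of
    the chains whose r = 1 vertices have t >= k, for decreasing k.  The maximal
    new simplex at level k is
      (0,0) < ... < (k,0) < (k,1) < ... < (n,1),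
    whose projection to Delta^n is the [k]-th degeneracy.  Removing the vertex
    (k,1) gives a face of the previous level, removing (k,0) gives the only
    new face, and the others lie over the boundary of Delta^n: the new simplex
    is attached along its [k]-th horn. *)
Lemma attach_prism k : k <= n -> forall R',
  partial_lift wP p R' ->
  (forall m (y : P m), dom R' y <-> dom R y \/ exists t,
     y.1 = act t x /\ forall v, 0 < (y.2 : mono m 1) v -> k < t v) ->
  exists R'', [/\ partial_lift wP p R'', extends R' R'' &
    forall m (y : P m), dom R'' y <-> dom R y \/ exists t,
      y.1 = act t x /\ forall v, 0 < (y.2 : mono m 1) v -> k <= t v].
Proof.
move=> kn R' R'P domR'.
have [v||g gE] := @mono_exists n.+1 n (fun v => v - (k < v)).
- by move: (ltn_ord v); lia.
- by move=> v v'; lia.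
have [v||h hE] := @mono_exists n.+1 1 (fun v => (k < v) : nat).
- by case: (k < v).
- by move=> v v'; lia.
have kn2 : k < n.+2 by rewrite ltnW // ltnS.
pose K : 'I_n.+2 := Ordinal kn2.
pose s : P n.+1 := (act g x, h).
have hit m (t : mono m n.+1) (j : nat) :
    ~~ in_horn K t -> j < n.+2 -> j <> k -> exists v, t v = j :> nat.
  rewrite negb_exists => /forallP /[swap] jn /(_ (Ordinal jn)).
  rewrite negb_and negbK => /orP[/eqP/(congr1 val)//|].
  by rewrite negbK => /codomP[v /(congr1 val) /= e] _; exists v.
have gtS m (t : mono m n.+1) : ~~ in_horn K t -> surjective (mono_comp g t).
  move=> tK l.
  have [||v tv] := hit _ t (l + (k <= l)) tK.
  - by move: (ltn_ord l); lia.
  - by lia.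
  by exists v; apply: val_inj; rewrite /= mono_compE gE tv; lia.
have [|||u|R'' [R''P RR'' domR'']] := @attach_horn _ _ _ _ _ R' n.+1 K s R'P.
- move=> m t /existsP[j /andP[jK jt]]; apply/domR'.
  have tj v : t v <> j :> nat.
    by move=> e; case/negP: jt; apply/codomP; exists v; apply: val_inj.
  have jk : j <> k :> nat by move=> e; case/eqP: jK; apply: val_inj.
  have [jk1|jk1] := eqVneq (nat_of_ord j) k.+1.
    right; exists (mono_comp g t); split; first by rewrite act_comp.
    move=> v; rewrite /= !mono_compE gE hE; move: (tj v); lia.
  left; rewrite /= -act_comp.
  suff : ~ surjective (mono_comp g t) by move=> /(minimal_face x full_sub Rlow).
  (* As j is neither k nor k + 1, only j lies over its image under [g]. *)
  move=> gt.
  have jn : j - (k < j) < n.+1 by move: (ltn_ord j); lia.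
  have [v] := gt (Ordinal jn); move=> /(congr1 val) /=.
  by rewrite mono_compE gE; move: (tj v); lia.
- move=> m t tK /domR' [] /=; rewrite -act_comp.
    (* The last vertex is (n, 1), so by saturation the whole prism over
       [x] would be in the domain. *)
    have [||v tv] := hit _ t n.+1 tK; [by []|lia|].
    have hv : 0 < mono_comp h t v by rewrite mono_compE hE tv; lia.
    move=> tR; apply: (minimal_degeneracy full_sub xR (gtS _ _ tK)) => s'.
    exact: Rsat (not_bottom hv) tR.
  (* The vertex k + 1, that is (k, 1), is not in the previous level. *)
  move=> [t' [tt' kt']].
  have e := minimal_inj full_sub xR Rlow (gtS _ _ tK) tt'.
  have [||v tv] := hit _ t k.+1 tK; [lia|lia|].
  have := kt' v; rewrite -e !mono_compE hE gE tv; lia.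
- move=> m t t' tK [] /=; rewrite -!act_comp => tt' /ffunP hh.
  have e := minimal_inj full_sub xR Rlow (gtS _ _ tK) tt'.
  apply: mono_eq => v.
  have := congr1 (fun a : mono m n => a v : nat) e; have := congr1 val (hh v).
  by rewrite /= !ffunE !hE !gE; lia.
- rewrite /= smap_nat; exact: pfill.
exists R''; split=> //.
move=> m [y r]; rewrite domR'' domR' /=; split.
- case=> [[yR|[t [yt rt]]]|[t []]]; [by left| |].
  + by right; exists t; split=> // v /rt /ltnW.
  + rewrite -act_comp => -> ->; right; exists (mono_comp g t); split=> // v.
    by rewrite !mono_compE hE gE; lia.
- case=> [yR|[t [yt rt]]]; first by do 2 left.
  have [[v [rv tv]]|nv] :=
      pselect (exists v, 0 < r v /\ t v = k :> nat); last first.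
    left; right; exists t; split=> // v rv; have := rt v rv.
    by rewrite leq_eqVlt => /orP[/eqP e|//]; case: nv; exists v.
  right.
  have r1 v' : r v' < 2 by apply: ltn_ord.
  (* The chain passes through (k, 1), so its r = 0 vertices have t <= k, and
     it factors through [s], where (i, 1) is the vertex number i + 1. *)
  have [v'||a aE] := @mono_exists m n.+1 (fun v => t v + r v).
  + by move: (ltn_ord (t v')) (r1 v'); lia.
  + by move=> v1 v2 v12; move: (monoP t v12) (monoP r v12); lia.
  have tr v' : r v' = 0 :> nat -> t v' <= k.
    move=> r0; rewrite -tv; apply: monoP; rewrite leqNgt; apply/negP.
    by move=> /ltnW /(monoP r); lia.
  exists a; rewrite /s -act_comp yt; congr (_, _); [congr act|];
    apply: mono_eq => v'; rewrite mono_compE ?gE ?hE aE;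
    move: (tr v') (rt v') (r1 v'); lia.
Qed.

Lemma attach_cell : exists R', [/\ partial_lift wP p R', saturated (dom R'),
  extends R R' & forall s, dom R' ((x, s) : P n)].
Proof.
suff H d : d <= n.+1 -> exists R',
    [/\ partial_lift wP p R', extends R R' &
    forall m (y : P m), dom R' y <-> dom R y \/ exists t,
     y.1 = act t x /\ forall v, 0 < (y.2 : mono m 1) v -> n.+1 - d <= t v].
  have [R' [R'P RR' domR']] := H n.+1 (leqnn _); exists R'; split=> //.
  - move=> m y s s' sb /domR' [yR|[t [yt _]]]; apply/domR'.
      by left; apply: Rsat sb yR.
    by right; exists t; split=> // v _; rewrite subnn.
  - move=> s; apply/domR'; right; exists (mono_id n).
    rewrite act_id; split=> // v _.
    by rewrite subnn.
elim: d => [_|d IH dn].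
  (* No vertex has t >= n + 1, so the first level is the bottom. *)
  exists R; split=> // m [y s]; split=> [|[//|[t [/= yt st]]]]; first by left.
  suff -> : s = bottom m by apply: Rbot.
  apply: mono_eq => v; rewrite mono_constE; apply/eqP; rewrite -leqn0 leqNgt.
  by apply/negP => /st; rewrite subn0 leqNgt ltn_ord.
have [R' [R'P RR' domR']] := IH (ltnW dn).
have [||R'' [R''P RR'' domR'']] := @attach_prism (n.+1 - d.+1) _ R' R'P.
- by lia.
- by rewrite (_ : n.+1 - d = (n.+1 - d.+1).+1) in domR'; last lia.
by exists R''; split=> // m y z /RR' /RR''.
Qed.

End Cell.

Lemma fiberwise_homotopy_extension (R : forall m, P m -> X m -> Prop) :
  partial_lift wP p R -> saturated (dom R) ->
  (forall m (y : N m), dom R ((y, bottom m) : P m)) ->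
  exists H : smap P X, scomp p H = wP /\ extends R (fun m y z => H m y = z).
Proof.
move=> RP Rsat Rbot.
have [|R' [R'P R'sat RR' R'max]] := maximal_partial_lift RP Rsat.
  by move=> J F _ Fsat m y s s' sb [i iy]; exists i; apply: Fsat sb iy.
have R'bot m (y : N m) : dom R' ((y, bottom m) : P m).
  by have [z zR] := Rbot m y; exists z; apply: RR'.
have full n : forall m (y : N m), m < n -> forall s, dom R' ((y, s) : P m).
  elim: n => [//|n IH] m y; rewrite ltnS leq_eqVlt.
  move=> /orP[/eqP e|]; last exact: IH.
  rewrite {m}e in y *; apply: contrapT => yR.
  have [R'' [R''P R''sat RR'' yR'']] := attach_cell R'P R'sat R'bot yR IH.
  apply: yR => s; have [z yz] := yR'' s.
  by exists z; apply: R'max yz.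
have [|||H HR] := @smap_of_graph P X R'.
- by move=> n [y s]; apply: (full n.+1).
- exact: (pl_fun R'P).
- exact: (pl_act R'P).
exists H; split.
  by apply: smap_ext => m y; apply: (pl_over R'P).
by move=> m y z /RR'; apply: (pl_fun R'P).
Qed.

End Cylinder.

(** * Edges of function complexes *)

Lemma map_over_str (S : sset) (M X : over S) n (h : map_over M X n) k
    (x : M k) (t : simplex n k) :
  str X k (sval h k (x, t)) = str M k x.
Proof.
exact: (congr1 (fun g : smap (sprod M (simplex n)) S => g k (x, t)) (svalP h)).
Qed.

Definition map_over_simplex (S : sset) (M X : over S) n
    (h : smap (sprod M (simplex n)) X)
    (hS : forall k (x : M k) t, str X k (h k (x, t)) = str M k x) :
  map_over M X n.
Proof. by exists h; apply: smap_ext => k [x t] /=; apply: hS. Defined.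

Lemma map_over_ext (S : sset) (M X : over S) n (h h' : map_over M X n) :
  (forall k (x : M k) t, sval h k (x, t) = sval h' k (x, t)) -> h = h'.
Proof.
case: h h' => [h hP] [h' hP'] /= hh; apply: eq_exist.
by apply: smap_ext => k [x t]; apply: hh.
Qed.

Lemma to_point n (s t : mono n 0) : s = t.
Proof. by apply: mono_ext => v; rewrite [s v]ord1 [t v]ord1. Qed.

(** Directed, so that orientations of edges can be tracked until they are shown
    not to matter. *)
Definition joined (K : sset) (x y : K 0) := exists e, edge_from_to x y e.

Lemma joined_refl (K : sset) (x : K 0) : joined x x.
Proof.
by exists (act (mono_const 1 ord0) x); split;
  rewrite -act_comp -[RHS]act_id; congr (act _ _); apply: to_point.
Qed.

Lemma smap_edge (K L : sset) (h : smap K L) (x y : K 0) e :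
  edge_between x y e -> edge_between (h 0 x) (h 0 y) (h 1 e).
Proof. by case=> -[<- <-]; [left|right]; split; rewrite smap_nat. Qed.

Lemma homotopic_vertex (K L : sset) (g h : smap K L) (x : K 0) :
  homotopic g h -> exists e, edge_between (g 0 x) (h 0 x) e.
Proof.
case=> H; have ev (f : smap K L) (k : 'I_2) :
    act (mono_const 0 k) H = shom_vertex f ->
    act (mono_const 0 k) (H 1 (act (mono_const 1 ord0) x, mono_id 1)) = f 0 x.
  pose pt := simplex 0.
  move=> /(congr1 (fun g : smap (sprod K pt) L => g 0 (x, mono_id 0))) /= <-.
  rewrite -smap_nat /= -act_comp; congr (H 0 (_, _)).
    by rewrite -[RHS]act_id; congr (act _ _); apply: to_point.
  by apply: mono_ext => v; rewrite !ffunE.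
by case=> -[H0 H1]; exists (H 1 (act (mono_const 1 ord0) x, mono_id 1));
  [left|right]; split; apply: ev.
Qed.

Section FunctionComplex.
Variables (S : sset) (M X : over S).
Hypothesis Xfill : fills_over_degeneracies (str X).

Lemma edge_end (x : map_over M X 0) (e : map_over M X 1) (k : 'I_2) n (y : M n)
    (t : mono n 0) :
  act (mono_const 0 k) e = x ->
  sval e n (y, mono_const n k) = sval x n (y, t).
Proof.
move=> <- /=; congr (sval e n (_, _)).
by apply: mono_ext => v; rewrite !ffunE.
Qed.

(** The square is M * Delta^1 * Delta^1: the first interval parametrizes [e]
    and the missing side, the second one [e0] and [e1].  The missing side is
    the end of a homotopy that starts at [e] and is prescribed over the two
    ends of the first interval. *)
Lemma joined_box (a b c d : map_over M X 0) :
  joined a b -> joined c d -> joined a c -> joined b d.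
Proof.
move=> [e0 [e0a e0b]] [e1 [e1c e1d]] [e [ea ec]].
pose I := simplex 1.
pose N := sprod M I.
pose bot n := mono_const n (ord0 : 'I_2).
pose top n := mono_const n (ord_max : 'I_2).
have bt n : bot n <> top n.
  by move=> /(congr1 (fun t : mono n 1 => t ord0 : nat)); rewrite !ffunE.
have act_bot m n (f : mono m n) : act f (bot n : I n) = bot m.
  exact: mono_comp_const.
have act_top m n (f : mono m n) : act f (top n : I n) = top m.
  exact: mono_comp_const.
pose w : smap N S := scomp (str M) (sfst M I).
pose R n (y : sprod N I n) (z : X n) :=
  [\/ y.2 = bot n /\ z = sval e n y.1,
      y.1.2 = bot n /\ z = sval e0 n (y.1.1, y.2) |
      y.1.2 = top n /\ z = sval e1 n (y.1.1, y.2)].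
have t0 n : mono n 0 := mono_const n ord0.
have e_e0 n x : sval e n (x, bot n) = sval e0 n (x, bot n).
  by rewrite (edge_end x (t0 n) ea) (edge_end x (t0 n) e0a).
have e_e1 n x : sval e n (x, top n) = sval e1 n (x, bot n).
  by rewrite (edge_end x (t0 n) ec) (edge_end x (t0 n) e1c).
have [|||H [HS HR]] := @fiberwise_homotopy_extension N X S w (str X) Xfill R.
- split.
  + move=> n [[x s] t] z z' [] /= [E ->] [] /= [E' ->]; rewrite ?E ?E' //;
      rewrite ?e_e0 ?e_e1 //; try by case: (@bt n); rewrite -E -E'.
  + move=> m n f [[x s] t] z [] /= [-> ->].
    * by constructor 1; split; [exact: act_bot|rewrite -smap_nat].
    * by constructor 2; split; [exact: act_bot|rewrite -smap_nat].
    * by constructor 3; split; [exact: act_top|rewrite -smap_nat].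
  + by move=> n [[x s] t] z [] /= [E ->]; rewrite map_over_str.
- move=> n [x s] t t' tb [z [] /= [E _]] //.
    by exists (sval e0 n (x, t')); constructor 2.
  by exists (sval e1 n (x, t')); constructor 3.
- by move=> n [x s]; exists (sval e n (x, s)); constructor 1.
have HSn n y : str X n (H n y) = str M n y.1.1.
  exact: (congr1 (fun g : smap (sprod N I) S => g n y) HS).
have Hnat m n (f : mono m n) (y : N n) :
    H m (act f y, top m) = act f (H n (y, top n)).
  by rewrite -smap_nat /=; congr (H m (_, _)); apply/esym/act_top.
pose h : smap N X := @SMap N X (fun n y => H n (y, top n)) Hnat.
have hS n (x : M n) t : str X n (h n (x, t)) = str M n x :=
  HSn n ((x, t), top n).
exists (map_over_simplex hS); split; apply: map_over_ext => n x t /=.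
- rewrite mono_comp_const -(edge_end x t e0b).
  by apply: HR; constructor 2.
- rewrite mono_comp_const -(edge_end x t e1d).
  by apply: HR; constructor 3.
Qed.

Lemma joined_sym (a b : map_over M X 0) : joined a b -> joined b a.
Proof. by move=> ab; apply: joined_box ab (joined_refl a) (joined_refl a). Qed.

Lemma joined_trans (a b c : map_over M X 0) :
  joined a b -> joined b c -> joined a c.
Proof. by move=> /joined_sym ba; apply: joined_box ba (joined_refl c). Qed.

Lemma edge_joined (a b : map_over M X 0) e : edge_between a b e -> joined a b.
Proof. by case=> ab; [|apply: joined_sym]; exists e. Qed.

End FunctionComplex.

(** * Precomposition and homotopies *)

Lemma over_map_of_vertex (S : sset) (M X : over S) (x : map_over M X 0) :
  exists f : over_map M X, map_over_vertex f = x.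
Proof.
have xN m n (a : mono m n) (y : M n) :
    sval x m (act a y, mono_const m ord0) =
      act a (sval x n (y, mono_const n ord0)).
  by rewrite -smap_nat /=; congr (sval x m (_, _)); apply: to_point.
pose f : smap M X := @SMap M X (fun n y => sval x n (y, mono_const n ord0)) xN.
have fS : scomp (str X) f = str M.
  by apply: smap_ext => n y; rewrite /= map_over_str.
exists (OverMap fS); apply: map_over_ext => n y t /=.
by congr (sval x n (_, _)); apply: to_point.
Qed.

Definition map_over_post (S : sset) (M X Y : over S) (f : over_map X Y) :
  smap (map_over M X) (map_over M Y).
Proof.
unshelve refine (@SMap (map_over M X) (map_over M Y)
  (fun n h => @map_over_simplex S M Y n (scomp f (sval h)) _) _).
- move=> k x t; rewrite -(map_over_str h x t).
  exact: (congr1 (fun g : smap X S => g k (sval h k (x, t))) (over_comm f)).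
- by move=> m n a h; apply: map_over_ext.
Defined.

(** Substituting the homotopy [e] : X * Delta^1 -> X between [c] and the
    identity into maps X -> W: on [n]-simplices, (h, t) goes to
    (x, s) |-> h (e (x, t s), s). *)
Lemma homotopic_precomp (S : sset) (X W : over S) (c : over_map X X)
    (f : smap (map_over X W) (map_over X W)) :
  fiberwise_homotopic c (oid X) ->
  (forall n (h : map_over X W n) k x t,
     sval (f n h) k (x, t) = sval h k (c k x, t)) ->
  homotopic f (sid (map_over X W)).
Proof.
move=> [e ce] fE.
pose K := map_over X W.
pose pre n (h : K n) (t : mono n 1) k (y : sprod X (simplex n) k) : W k :=
  sval h k (sval e k (y.1, mono_comp t y.2), y.2).
have preN n h t l k (a : mono l k) (y : sprod X (simplex n) k) :
    @pre n h t l (act a y) = act a (pre n h t k y).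
  rewrite /pre -smap_nat /= -smap_nat /=; congr (sval h l (sval e l (_, _), _)).
  by apply: mono_ext => v; rewrite !ffunE.
pose preM n h t : smap (sprod X (simplex n)) W := SMap (preN n h t).
have preS n (h : K n) t k x s : str W k (preM n h t k (x, s)) = str X k x.
  by rewrite /= /pre !map_over_str.
pose H n (ht : sprod K (simplex 1) n) : K n :=
  map_over_simplex (preS n ht.1 ht.2).
have HN m n (a : mono m n) ht : H m (act a ht) = act a (H n ht).
  apply: map_over_ext => k x s /=; rewrite /pre /=.
  congr (sval (ht.1) k (sval e k (_, _), _)).
  by apply: mono_ext => v; rewrite !ffunE.
exists (SMap HN).
have Hend (g : smap K K) (d : over_map X X) (i : 'I_2) :
    act (mono_const 0 i) e = map_over_vertex d ->
    (forall n (h : K n) k x t, sval (g n h) k (x, t) = sval h k (d k x, t)) ->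
    act (mono_const 0 i) (SMap HN : shom K K 1) = shom_vertex g.
  move=> ed gE; apply: smap_ext => n [h t]; apply: map_over_ext => k x s.
  rewrite gE /= /pre /=; congr (sval h k (_, _)).
  rewrite -(edge_end x (mono_const k ord0) ed : _ = d k x).
  by congr (sval e k (_, _)); apply: mono_ext => v; rewrite !ffunE.
by case: ce => -[e0 e1]; [left|right]; split;
  [apply: Hend e0 _|apply: Hend e1 _|apply: Hend e0 _|apply: Hend e1 _].
Qed.

Theorem lemma4p14 :
  forall (A B : sset) (X Y : over (sprod A B)) (f : over_map X Y),
    (fiberwise_homotopy_equivalence f -> bivariant_equivalence f) /\
    (bifibration (str X) -> bifibration (str Y) ->
     bivariant_equivalence f -> fiberwise_homotopy_equivalence f).
Proof.
move=> A B X Y f; split=> [[k [fk kf]] W _|Xb Yb fe].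
  exists (map_over_pre k W); split.
    by apply: homotopic_precomp kf _.
  by apply: homotopic_precomp fk _.
have [g [fg _]] := fe X Xb.
have [k kE] := over_map_of_vertex (g 0 (map_over_vertex (oid X))).
have [e kf] : fiberwise_homotopic (ocomp k f) (oid X).
  have [e E] := homotopic_vertex (map_over_vertex (oid X)) fg.
  exists e; rewrite /fiberwise_homotopy.
  suff -> : map_over_vertex (ocomp k f) =
      scomp (map_over_pre f X) g 0 (map_over_vertex (oid X)) by [].
  rewrite -[RHS]/(map_over_pre f X 0 (g 0 _)) -kE.
  exact: map_over_ext.
exists k; split; last by exists e.
(* Chain: fk -- g' (f^* (fk)) -- g' (f^* 1_Y) -- 1_Y, the middle edge being
   the image under g' of the edge between f^* (fk) = f (kf) and f = f^* 1_Y. *)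
have [g' [_ g'f]] := fe Y Yb.
have Yfill := bifibration_fills Yb.
pose a := map_over_vertex (ocomp f k); pose b := map_over_vertex (oid Y).
have [e1 /(edge_joined Yfill) E1] := homotopic_vertex a g'f.
have [e2 /(edge_joined Yfill) E2] := homotopic_vertex b g'f.
have /(smap_edge (map_over_post X f)) /(smap_edge g') := kf.
have -> : map_over_post X f 0 (map_over_vertex (ocomp k f)) =
    map_over_pre f Y 0 a.
  exact: map_over_ext.
have -> : map_over_post X f 0 (map_over_vertex (oid X)) = map_over_pre f Y 0 b.
  exact: map_over_ext.
move=> /(edge_joined Yfill) E3.
have [e4 E4] := joined_trans Yfill (joined_sym Yfill E1)
  (joined_trans Yfill E3 E2).
by exists e4; left.
Qed.
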